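(* (Biconditional AND rule.) Let $A,B$ be logically independent events. Then $\{A|B,\,B|A\}$ p-entails $(A|B)\wedge(B|A)$. That is, the assessment $(1,1)$ on $\{A|B,B|A\}$ is coherent, and for every coherent assessment $(x,y,z)$ on $\{A|B,\ B|A,\ (A|B)\wedge(B|A)\}$, if $x=y=1$ then $z=1$.
   Context: Events are elements of a Boolean algebra with sure event $\Omega$ and impossible event $\emptyset$; $\overline{E}$ is negation, $EF$ is conjunction, and an event is identified with its $0/1$ indicator. $A,B$ are logically independent if $AB,\ A\overline B,\ \overline AB,\ \overline A\,\overline B$ (the constituents) are all $\neq\emptyset$. With $P(A|B)=x$, $P(B|A)=y$, the conditional event $A|B$ is numerically $AB+x\overline B$, $B|A$ is $AB+y\overline A$, and their conjunction is the conditional random quantity $(A|B)\wedge(B|A)=\min\{AB+x\overline B,\ AB+y\overline A\}\,|\,(A\vee B)$: it equals that minimum when $A\vee B$ is true and equals its prevision $z$ when $\overline A\,\overline B$ is true. Coherence: associate gains $G_1=B(A-x)$, $G_2=A(B-y)$, $G_3=(A|B)\wedge(B|A)-z$ and conditioning events $L_1=B$, $L_2=A$, $L_3=A\vee B$. An assessment on (a subfamily of) the family is coherent if for every nonempty set $S$ of corresponding indices and all reals $s_i$, the set $D$ of values of $\sum_{i\in S}s_iG_i$ on the constituents contained in $\bigvee_{i\in S}L_i$ satisfies $\min D\le0\le\max D$. A family is p-consistent if assigning $1$ to all members is coherent; a p-consistent family p-entails a further quantity if in every coherent assessment giving $1$ to all members of the family the further quantity also has prevision $1$. *)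

(* Defs.v *)
From HB Require Import structures.
From mathcomp Require Import all_boot all_order all_algebra.
From mathcomp Require Import reals.

Set Implicit Arguments.
Unset Strict Implicit.
Unset Printing Implicit Defensive.

Import Order.TTheory GRing.Theory Num.Theory.
Local Open Scope ring_scope.

(* Indices of A|B, B|A and (A|B) /\ (B|A). *)
Inductive quantity := AgB | BgA | Conj.

Definition ord_of_quantity (q : quantity) : 'I_3 :=
  match q with
  | AgB => @Ordinal 3 0 isT
  | BgA => @Ordinal 3 1 isT
  | Conj => @Ordinal 3 2 isT
  end.

Definition quantity_of_ord (i : 'I_3) : quantity :=
  match val i with
  | 0 => AgB
  | 1 => BgA
  | _ => Conj
  end.

Lemma ord_of_quantityK : cancel ord_of_quantity quantity_of_ord.
Proof. by case. Qed.

HB.instance Definition _ := Countable.copy quantity (can_type ord_of_quantityK).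

Lemma quantity_enumP : Finite.axiom [:: AgB; BgA; Conj].
Proof. by case. Qed.

HB.instance Definition _ := isFinite.Build quantity quantity_enumP.

Section Events.

(* A ctbDistrLatticeType is a Boolean algebra: \top is the sure event,
   \bot the impossible one, and ~`, `&`, `|` are the connectives. *)
Variables (d : Order.disp_t) (T : ctbDistrLatticeType d).

Definition logically_independent (A B : T) : Prop :=
  [/\ A `&` B != \bot, A `&` ~` B != \bot,
      ~` A `&` B != \bot & ~` A `&` ~` B != \bot]%O.

Definition constituents (A B : T) : seq T :=
  [seq C <- [:: A `&` B; A `&` ~` B; ~` A `&` B; ~` A `&` ~` B]%O
  | C != \bot%O].

Definition conditioning (A B : T) (q : quantity) : T :=
  match q with
  | AgB => B
  | BgA => A
  | Conj => (A `|` B)%O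
  end.

Variable R : realType.

(* Value of the indicator of E on a constituent C; a constituent lies below
   either E or its complement for every E in the algebra generated by A, B. *)
Definition indicator (E C : T) : R := (C <= E)%O%:R.

(* An assessment p gives x = p AgB, y = p BgA, z = p Conj. *)

Definition AgB_value (A B : T) (x : R) (C : T) : R :=
  indicator (A `&` B)%O C + x * indicator (~` B)%O C.

Definition BgA_value (A B : T) (y : R) (C : T) : R :=
  indicator (A `&` B)%O C + y * indicator (~` A)%O C.

Definition conj_value (A B : T) (x y z : R) (C : T) : R :=
  if (C <= A `|` B)%O then Num.min (AgB_value A B x C) (BgA_value A B y C)
  else z.

Definition gain (A B : T) (p : quantity -> R) (q : quantity) (C : T) : R :=
  match q with
  | AgB => indicator B C * (indicator A C - p AgB)
  | BgA => indicator A C * (indicator B C - p BgA)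
  | Conj => conj_value A B (p AgB) (p BgA) (p Conj) C - p Conj
  end.

(* For D = [::] both are 0. *)
Definition seq_min (D : seq R) : R := \big[Num.min/head 0 D]_(v <- D) v.
Definition seq_max (D : seq R) : R := \big[Num.max/head 0 D]_(v <- D) v.

Definition gain_values (A B : T) (p : quantity -> R) (S : {set quantity})
    (s : quantity -> R) : seq R :=
  [seq \sum_(i in S) s i * gain A B p i C
  | C <- constituents A B & (C <= \join_(i in S) conditioning A B i)%O].

(* Coherence of the restriction of p to the subfamily J. The gains of A|B and
   B|A do not involve p Conj, so for J = {A|B, B|A} only the values of p on J
   matter. *)
Definition coherent (A B : T) (J : {set quantity}) (p : quantity -> R) : Prop :=
  forall S : {set quantity}, S != set0 -> S \subset J ->
  forall s : quantity -> R,
    seq_min (gain_values A B p S s) <= 0 <= seq_max (gain_values A B p S s).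

Definition p_consistent (A B : T) (J : {set quantity}) : Prop :=
  coherent A B J (fun=> 1).

Definition p_entails (A B : T) (J : {set quantity}) (k : quantity) : Prop :=
  p_consistent A B J /\
  forall p : quantity -> R, coherent A B (k |: J) p ->
    (forall q, q \in J -> p q = 1) -> p k = 1.

End Events.

(* Main.v *)
Require Import Defs.
From mathcomp Require Import all_boot all_order all_algebra.
From mathcomp Require Import reals.
From mathcomp Require Import ring.

(** On [A `|` B], when x = y = 1, the bet (A|B)/\(B|A) - A|B - B|A has the
    constant gain 1 - z, so coherence forces 1 - z <= 0 <= 1 - z. Conversely,
    (1, 1) is coherent on {A|B, B|A} because on A `&` B, which lies below every
    conditioning event, both gains vanish. *)

Set Implicit Arguments.
Unset Strict Implicit.
Unset Printing Implicit Defensive.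

Import Order.Theory GRing.Theory Num.Theory.
Local Open Scope ring_scope.

(** Membership survives the fold because a binary minimum is one of its arguments, and the default
    [head 0 D] is itself a member once [D] is nonempty. *)
Lemma seq_min_mem (R : realType) (D : seq R) : D != [::] -> seq_min D \in D.
Proof.
move=> D0; rewrite /seq_min big_seq; apply: (big_ind (fun v => v \in D)) => //.
- by case: D D0 => //= a D _; rewrite inE eqxx.
- by move=> x y Dx Dy; rewrite minElt; case: ifP.
Qed.

Lemma seq_max_mem (R : realType) (D : seq R) : D != [::] -> seq_max D \in D.
Proof.
move=> D0; rewrite /seq_max big_seq; apply: (big_ind (fun v => v \in D)) => //.
- by case: D D0 => //= a D _; rewrite inE eqxx.
- by move=> x y Dx Dy; rewrite maxElt; case: ifP.
Qed.

Lemma seq_min_le (R : realType) (D : seq R) (v : R) : v \in D -> seq_min D <= v.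
Proof. by move=> Dv; apply: (ge_bigmin_seq _ v xpredT id). Qed.

Lemma le_seq_max (R : realType) (D : seq R) (v : R) : v \in D -> v <= seq_max D.
Proof. by move=> Dv; apply: (le_bigmax_seq _ v xpredT id). Qed.

Section BiconditionalAnd.

Variables (d : Order.disp_t) (T : ctbDistrLatticeType d) (R : realType).
Implicit Types (A B C E : T) (p s : quantity -> R) (S : {set quantity}).

Lemma le_compl_nle E C : C != \bot%O -> (C <= ~` E)%O -> (C <= E)%O = false.
Proof.
move=> C0 CE; apply: contraNF C0 => CE'.
by rewrite -lex0 -(meetxC E) lexI CE' CE.
Qed.

Lemma compl_nle E C : C != \bot%O -> (C <= E)%O -> (C <= ~` E)%O = false.
Proof. by move=> C0 CE; apply: le_compl_nle; rewrite ?complK. Qed.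

Lemma gain_ones_meet A B q :
  q \in [set AgB; BgA] -> gain A B (fun=> 1 : R) q (A `&` B)%O = 0.
Proof.
by case: q; rewrite !inE //= /indicator ?leIl ?leIr subrr mulr0.
Qed.

Lemma conditioning_join A B S q : q \in S ->
  (conditioning A B q <= \join_(i in S) conditioning A B i)%O.
Proof. by move=> Sq; apply: joins_sup. Qed.

Lemma meet_le_conditioning A B q : (A `&` B <= conditioning A B q)%O.
Proof. by case: q; rewrite /= ?leIl ?leIr // (le_trans (leIl _ _)) ?leUl. Qed.

Lemma p_consistent_conditionals A B :
  (A `&` B != \bot)%O -> p_consistent R A B [set AgB; BgA].
Proof.
move=> AB0 S /set0Pn[q Sq] /subsetP SJ s.
(* A value 0 in the list bounds the minimum above and the maximum below. The member [q] of [S] is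
   what puts [A] meet [B] below the join of the conditioning events. *)
suff D0 : 0 \in gain_values A B (fun=> 1) S s.
  by rewrite seq_min_le ?le_seq_max.
apply/mapP; exists (A `&` B)%O.
  rewrite mem_filter /constituents mem_filter AB0 !inE eqxx !andbT.
  exact: le_trans (meet_le_conditioning A B q) (conditioning_join _ _ Sq).
by rewrite big1 // => i Si; rewrite gain_ones_meet ?mulr0 ?SJ.
Qed.

Definition and_bet (q : quantity) : R := if q is Conj then 1 else -1.

(** If [C] is [A] meet [B], the conjunction is worth 1 and both conditionals gain 0. On the two
    constituents where just one of [A], [B] holds, the conjunction is worth 0 and exactly one
    conditional gains -1, which its stake -1 turns into the missing 1. *)
Lemma gain_and_bet A B p C :
  p AgB = 1 -> p BgA = 1 -> C \in constituents A B -> (C <= A `|` B)%O ->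
  \sum_(q in setT) and_bet q * gain A B p q C = 1 - p Conj.
Proof.
move=> x1 y1; rewrite mem_filter => /andP[C0 Cin] CU.
have -> : \sum_(q in setT) and_bet q * gain A B p q C =
    gain A B p Conj C - gain A B p AgB C - gain A B p BgA C.
  rewrite (bigD1 AgB) ?inE // (bigD1 BgA) ?inE // (bigD1 Conj) ?inE //.
  rewrite big1 => [|[]]; rewrite ?inE //=; ring.
rewrite /gain /conj_value /AgB_value /BgA_value /indicator CU x1 y1 !lexI.
(* A nonzero [C] cannot lie below both an event and its complement. A constituent lies below one of
   the two for [A] and for [B], so the identity reduces to a check over truth values. *)
have cases E : (C <= E)%O \/ (C <= ~` E)%O ->
    (C <= ~` E)%O = ~~ (C <= E)%O.
  by case=> CE; [rewrite (compl_nle C0 CE) CE | rewrite (le_compl_nle C0 CE) CE].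
have AC : (C <= ~` A)%O = ~~ (C <= A)%O.
  apply: cases; move: Cin; rewrite !inE.
  by case/or4P=> /eqP->; rewrite ?leIl; auto.
have BC : (C <= ~` B)%O = ~~ (C <= B)%O.
  apply: cases; move: Cin; rewrite !inE.
  by case/or4P=> /eqP->; rewrite ?leIr; auto.
(* By De Morgan, failing both would put [C] below the complement of [A] join [B], against [CU]. *)
have AB : (C <= A)%O || (C <= B)%O.
  rewrite -[_ || _]negbK negb_or -AC -BC -lexI -complU.
  by rewrite compl_nle.
rewrite AC BC; move: AB.
case: (C <= A)%O; case: (C <= B)%O => //= _;
  rewrite ?mul1r ?mulr0 ?mulr1 ?addr0 ?add0r ?minxx ?(min_r ler01) ?(min_l ler01);
  ring.
Qed.

Lemma coherent_conj_eq1 A B p :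
  (A `&` B != \bot)%O -> coherent A B setT p ->
  p AgB = 1 -> p BgA = 1 -> p Conj = 1.
Proof.
move=> AB0 coh x1 y1.
have T0 : [set: quantity] != set0 by apply/set0Pn; exists Conj; rewrite inE.
have /andP[] := coh _ T0 (subsetT _) and_bet.
set D := gain_values _ _ _ _ _.
have DE v : v \in D -> v = 1 - p Conj.
  case/mapP=> C; rewrite mem_filter => /andP[CU Cc] ->; apply: gain_and_bet => //.
  apply: le_trans CU _; apply/joinsP => -[] _ //=; [exact: leUr|exact: leUl].
(* An empty list would have minimum and maximum 0 by default, and coherence would say nothing about
   [p Conj]; the constituent [A] meet [B] rules this out. *)
have D0 : D != [::].
  rewrite -size_eq0 size_map size_filter -lt0n -has_count; apply/hasP.
  exists (A `&` B)%O; first by rewrite mem_filter AB0 inE eqxx.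
  apply: le_trans (meet_le_conditioning A B Conj) _.
  by apply: conditioning_join; rewrite inE.
rewrite (DE _ (seq_min_mem D0)) (DE _ (seq_max_mem D0)) subr_le0 subr_ge0.
by move=> h1 h2; apply/eqP; rewrite eq_le h1 h2.
Qed.

End BiconditionalAnd.

Theorem mainTheorem10 (d : Order.disp_t) (T : ctbDistrLatticeType d)
    (R : realType) (A B : T) :
  logically_independent A B ->
  p_entails R A B [set AgB; BgA] Conj.
Proof.
case=> AB0 _ _ _; split; first exact: p_consistent_conditionals.
move=> p; have -> : Conj |: [set AgB; BgA] = setT.
  by apply/setP => -[]; rewrite !inE.
move=> coh p1; apply: (coherent_conj_eq1 AB0 coh); apply: p1; by rewrite !inE.
Qed.
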